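(* Fix any $\lambda>0$ and $\tau>0$. For any $z\in\mathbb{R}^n$, letting $P$ be an $n\times n$ signed permutation matrix such that $Pz=|z|^{\downarrow}$, it holds that $\mathcal{P}_{\tau}g_{\lambda}(z)=P^{\mathbb{T}}\mathcal{Q}_{\tau\lambda}(|z|^{\downarrow})$, where $$\mathcal{Q}_{\nu}(y):=\mathop{\arg\min}_{x\in\mathbb{R}^n}\Big\{\frac12\|x-y\|^2+\nu\|x\|_0\ \ \text{s.t.}\ \|x\|=1\Big\}\qquad\forall y\in\mathbb{R}^n.$$ For any $y\neq 0$ with $y_1\ge\cdots\ge y_n\ge 0$ and $\nu>0$, letting $\chi_j(y):=\|y^{j,\downarrow}\|-\|y^{j-1,\downarrow}\|$ with $y^{0,\downarrow}=0$: - $\mathcal{Q}_{\nu}(y)=\{\frac{y}{\|y\|}\}$ if $\nu\le\chi_n(y)$; - $\mathcal{Q}_{\nu}(y)=\big\{(\frac{y_i}{|y_i|},0,\ldots,0)^{\mathbb{T}}\ |\ i\in[n]\text{ is such that }y_i=y_1\big\}$ if $\nu\ge\chi_1(y)$; - otherwise $\mathcal{Q}_{\nu}(y)=\big\{(\frac{y^{l,\downarrow}}{\|y^{l,\downarrow}\|};0)\ |\ l\in[n]\text{ is such that }\nu\in(\chi_{l+1}(y),\chi_l(y)]\big\}$.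
   Context: $\mathcal{S}=\{x\in\mathbb{R}^n:\|x\|=1\}$, $\delta_{\mathcal{S}}$ is its indicator function, $\|x\|_0$ is the number of nonzero entries of $x$, $\|\cdot\|$ is the Euclidean norm, and $[n]=\{1,\ldots,n\}$. $g_{\lambda}(x):=\delta_{\mathcal{S}}(x)+\lambda\|x\|_0$. The (set-valued) proximal mapping of $h$ with parameter $\tau>0$ is $\mathcal{P}_{\tau}h(x):=\arg\min_{z\in\mathbb{R}^n}\{\frac{1}{2\tau}\|z-x\|^2+h(z)\}$. For a vector $z$, $|z|$ is the entrywise absolute value, $z^{\downarrow}$ is the vector of entries of $z$ arranged in nonincreasing order, and $z^{s,\downarrow}=(z_1^{\downarrow},\ldots,z_s^{\downarrow})^{\mathbb{T}}$ consists of its first $s$ entries. $(u;0)$ denotes the vector in $\mathbb{R}^n$ obtained by padding $u$ with zeros, and a matrix times a set is the set of images.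
   Formalization: As printed it fails at ν=χ_l (l≥2) and for ties in y. Proved for n≥1: case 1 needs ν<χ_n; case 2 puts y_i/|y_i| at position i; case 3 covers χ_n≤ν<χ_1 with closed [χ_{l+1},χ_l], χ_{n+1}=0, and all truncations up to permutations fixing y. *)

(* Defs.v *)
From mathcomp Require Import all_boot all_order all_algebra all_fingroup.
From mathcomp Require Import all_classical all_reals.

Set Implicit Arguments.
Unset Strict Implicit.
Unset Printing Implicit Defensive.

Import Order.TTheory GRing.Theory Num.Theory.
Local Open Scope classical_set_scope.
Local Open Scope ring_scope.

(* Euclidean norm; the norm `|x| that mathcomp-analysis puts on matrices is
   the sup norm, hence this separate definition. *)
Definition enorm (R : realType) (n : nat) (x : 'cV[R]_n) : R :=
  Num.sqrt (\sum_(i < n) x i 0 ^+ 2).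

Definition l0norm (R : realType) (n : nat) (x : 'cV[R]_n) : nat :=
  #|[pred i | x i 0 != 0]|.

Definition sphere (R : realType) (n : nat) : set 'cV[R]_n :=
  [set x | enorm x = 1].

(* Indicator function of convex analysis: 0 on A and +oo outside A. *)
Definition delta_set (R : realType) (T : Type) (A : set T) (x : T) : \bar R :=
  if `[< A x >] then 0%E else +oo%E.

Definition argmin (R : realType) (T : Type) (A : set T) (f : T -> \bar R) :
    set T :=
  [set x | A x /\ forall w, A w -> (f x <= f w)%E].

Definition prox (R : realType) (n : nat) (tau : R) (h : 'cV[R]_n -> \bar R)
    (x : 'cV[R]_n) : set 'cV[R]_n :=
  argmin setT
    (fun z => ((2 * tau)^-1 * enorm (z - x) ^+ 2)%:E + h z)%E.

Definition gfun (R : realType) (n : nat) (lambda : R) (x : 'cV[R]_n) :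
    \bar R :=
  (delta_set R (@sphere R n) x + (lambda * (l0norm x)%:R)%:E)%E.

Definition Qset (R : realType) (n : nat) (nu : R) (y : 'cV[R]_n) :
    set 'cV[R]_n :=
  argmin (@sphere R n)
    (fun x => (2^-1 * enorm (x - y) ^+ 2 + nu * (l0norm x)%:R)%:E).

Definition absv (R : realType) (n : nat) (z : 'cV[R]_n) : 'cV[R]_n :=
  \col_i `|z i 0|.

Definition sort_desc (R : realType) (n : nat) (z : 'cV[R]_n) : seq R :=
  sort >=%R [seq z i 0 | i <- enum 'I_n].

Definition sortv (R : realType) (n : nat) (z : 'cV[R]_n) : 'cV[R]_n :=
  \col_i (sort_desc z)`_i.

(* The first s entries of sortv z. Entries past the n-th one are 0, so that
   chi n.+1 y = 0. *)
Definition top (R : realType) (n s : nat) (z : 'cV[R]_n) : 'cV[R]_s :=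
  \col_(j < s) (sort_desc z)`_j.

Definition pad0 (R : realType) (n s : nat) (u : 'cV[R]_s) : 'cV[R]_n :=
  \col_(i < n) oapp (fun j : 'I_s => u j 0) 0 (insub (val i)).

Definition chi (R : realType) (n j : nat) (y : 'cV[R]_n) : R :=
  enorm (top j y) - enorm (top j.-1 y).

Definition normalize (R : realType) (n : nat) (y : 'cV[R]_n) : 'cV[R]_n :=
  (enorm y)^-1 *: y.

Definition signed_perm_mx (R : realType) (n : nat) (P : 'M[R]_n) : Prop :=
  exists (eps : 'I_n -> bool) (s : 'S_n),
    P = diag_mx (\row_i (-1) ^+ eps i) *m perm_mx s.

(* The vectors obtained from the normalized l largest entries of y, padded
   with zeros, by putting these entries back at the positions they come from.
   When y has ties there are several ways of sorting it, and each of them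
   gives such a vector. *)
Definition top_truncations (R : realType) (n l : nat) (y : 'cV[R]_n) :
    set 'cV[R]_n :=
  [set P^T *m pad0 n (normalize (top l y)) |
    P in [set P : 'M[R]_n | is_perm_mx P /\ P *m y = sortv y]].

(* Main.v *)
Require Import Defs.
From mathcomp Require Import all_boot all_order all_algebra all_fingroup.
From mathcomp Require Import all_classical all_reals.
From mathcomp Require Import ring lra.

Set Implicit Arguments.
Unset Strict Implicit.
Unset Printing Implicit Defensive.

Import Order.TTheory GRing.Theory Num.Theory.
Local Open Scope classical_set_scope.
Local Open Scope ring_scope.

(** On the unit sphere the objective of [Qset nu y] is, up to the constant
    (1 + |y|^2)/2, equal to nu |x|_0 - <x, y>.  The problem thus splits into
    choosing a support size k and maximizing <x, y> over the unit vectors x with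
    k nonzero entries.

    For y nonzero, nonnegative and nonincreasing, <x, y> is then at most the
    norm p_k of the first k entries of y: Cauchy-Schwarz on the support S of x
    bounds <x, y> by the norm of y restricted to S, and no k entries of y have a
    larger norm than the first k.  Equality forces x to be proportional to y on S, and
    forces S to differ from the first k positions only at positions where y
    takes one common value; a permutation that fixes y then carries x to the
    normalized truncation of y ([dot_le_prefix_norm]).

    What remains is to minimize nu k - p_k over 1 <= k <= n.  Since the
    differences p_(k+1)^2 - p_k^2 = y_(k+1)^2 do not increase with k, the
    sequence p is concave ([prefix_norm_concave]), that is, its increments chi_k
    are nonincreasing, and a local minimum l is a global one.  Local minimality
    means chi_(l+1) <= nu <= chi_l, without the upper bound when l = 1.  This
    gives a uniform description of the minimizers ([Qset_sortedE]); the three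
    regimes of nu say whether l is n, is 1, or ranges over the solutions of the
    two inequalities.  For nu = chi_1, that l = 1 is the only choice comes from
    the strict inequality chi_2 < chi_1.

    The reduction of the proximal mapping to sorted nonnegative vectors holds
    because a signed permutation matrix is orthogonal and preserves the number
    of nonzero entries. *)

(** * Euclidean norm and inner product *)

Definition dot (R : realType) (n : nat) (x y : 'cV[R]_n) : R :=
  \sum_(i < n) x i 0 * y i 0.

Lemma enorm_ge0 (R : realType) (n : nat) (x : 'cV[R]_n) : 0 <= enorm x.
Proof. exact: sqrtr_ge0. Qed.

Lemma sqr_enorm (R : realType) (n : nat) (x : 'cV[R]_n) :
  enorm x ^+ 2 = \sum_(i < n) x i 0 ^+ 2.
Proof. by rewrite sqr_sqrtr// sumr_ge0// => i _; exact: sqr_ge0. Qed.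

Lemma enorm_gt0 (R : realType) (n : nat) (x : 'cV[R]_n) :
  x != 0 -> 0 < enorm x.
Proof.
move=> x0; rewrite sqrtr_gt0 lt_def sumr_ge0 ?andbT => [|i _]; last first.
  exact: sqr_ge0.
apply: contra x0; rewrite psumr_eq0 => [/allP h|i _]; last exact: sqr_ge0.
apply/eqP/colP => i; rewrite mxE.
by have /= := h i (mem_index_enum _); rewrite sqrf_eq0 => /eqP.
Qed.

Lemma enorm_normalize (R : realType) (n : nat) (x : 'cV[R]_n) :
  x != 0 -> enorm (normalize x) = 1.
Proof.
move=> /enorm_gt0 x0; apply/eqP.
rewrite -(eqrXn2 (n := 2))// ?enorm_ge0// sqr_enorm expr1n.
under eq_bigr do rewrite mxE exprMn.
by rewrite -mulr_sumr -sqr_enorm exprVn mulVf// expf_neq0// gt_eqF.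
Qed.

Lemma sqr_enormB (R : realType) (n : nat) (x y : 'cV[R]_n) :
  enorm (x - y) ^+ 2 = enorm x ^+ 2 - 2 * dot x y + enorm y ^+ 2.
Proof.
rewrite !sqr_enorm mulr_sumr -sumrB -big_split; apply: eq_bigr => i _.
by rewrite !mxE /=; ring.
Qed.

(** * Norms of the initial segments of a nonincreasing sequence *)

(** Indexing by all of [nat] rather than by ['I_n] gives a meaning to the
    increment that follows the last entry of a vector continued by zeros. *)
Definition prefix_norm (R : realType) (Y : nat -> R) (k : nat) : R :=
  Num.sqrt (\sum_(i < k) Y i ^+ 2).

Section PrefixNorm.
Variables (R : realType) (Y : nat -> R).
Hypotheses (Y_ge0 : forall k, 0 <= Y k)
  (Y_anti : forall j k, (j <= k)%N -> Y k <= Y j).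

Lemma prefix_norm_ge0 k : 0 <= prefix_norm Y k.
Proof. exact: sqrtr_ge0. Qed.

Lemma sqr_prefix_norm k : prefix_norm Y k ^+ 2 = \sum_(i < k) Y i ^+ 2.
Proof. by rewrite sqr_sqrtr// sumr_ge0// => i _; exact: sqr_ge0. Qed.

Lemma sqr_prefix_normS k :
  prefix_norm Y k.+1 ^+ 2 = prefix_norm Y k ^+ 2 + Y k ^+ 2.
Proof. by rewrite !sqr_prefix_norm big_ord_recr. Qed.

Lemma prefix_norm0 : prefix_norm Y 0 = 0.
Proof. by rewrite /prefix_norm big_ord0 sqrtr0. Qed.

Lemma prefix_norm1 : prefix_norm Y 1 = Y 0.
Proof. by rewrite /prefix_norm big_ord1 sqrtr_sqr ger0_norm. Qed.

Lemma prefix_norm_gt0 k : 0 < Y 0 -> (0 < k)%N -> 0 < prefix_norm Y k.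
Proof.
case: k => // k Y0 _; rewrite sqrtr_gt0 big_ord_recl ltr_pwDl ?exprn_gt0//.
by rewrite sumr_ge0// => i _; exact: sqr_ge0.
Qed.

(** The squares of consecutive values differ by (Y k)^2, hence the increments
    are (Y k)^2 / (p_k + p_(k+1)) wherever the denominator is nonzero: the
    numerator does not increase, and the denominator does not decrease. *)
Lemma prefix_norm_concave k :
  prefix_norm Y k.+2 - prefix_norm Y k.+1 <=
  prefix_norm Y k.+1 - prefix_norm Y k.
Proof.
have hb := sqr_prefix_normS k; have hc := sqr_prefix_normS k.+1.
have hY : Y k.+1 ^+ 2 <= Y k ^+ 2 by rewrite lerXn2r ?nnegrE// Y_anti.
have hk : 0 <= Y k.+1 ^+ 2 by exact: sqr_ge0.
move: (prefix_norm_ge0 k) (prefix_norm_ge0 k.+1) (prefix_norm_ge0 k.+2).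
move: (prefix_norm Y k) (prefix_norm Y k.+1) (prefix_norm Y k.+2) hb hc hY hk.
move: (Y k ^+ 2) (Y k.+1 ^+ 2) => u v a b c hb hc vu v0 a0 b0 c0.
rewrite leNgt; apply/negP => hlt.
have ab : a <= b by rewrite -(@ler_pXn2r _ 2)// ?nnegrE//; lra.
have bc : b <= c by rewrite -(@ler_pXn2r _ 2)// ?nnegrE//; lra.
nra.
Qed.

(** Strictness of the first comparison of increments is what excludes supports
    of size 2 when the penalty is exactly the first increment; it holds because
    p_2 is at most sqrt 2 * p_1. *)
Lemma prefix_norm2_lt :
  0 < Y 0 -> prefix_norm Y 2 - prefix_norm Y 1 < prefix_norm Y 1.
Proof.
move=> Y0; have h := sqr_prefix_normS 1; rewrite prefix_norm1 in h *.
have hY : Y 1 ^+ 2 <= Y 0 ^+ 2 by rewrite lerXn2r ?nnegrE// Y_anti.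
have := prefix_norm_ge0 2.
nra.
Qed.

End PrefixNorm.

(** * Local minima of convex sequences *)

Section ConvexSequence.
Variables (R : realType) (f : nat -> R).
Hypothesis f_convex : forall k, f k.+1 - f k <= f k.+2 - f k.+1.

Lemma convex_slope_le j k : (j <= k)%N -> f j.+1 - f j <= f k.+1 - f k.
Proof.
elim: k => [|k IH]; first by rewrite leqn0 => /eqP ->.
rewrite leq_eqVlt ltnS => /predU1P[->//|/IH h].
exact: le_trans h (f_convex k).
Qed.

Lemma convex_min_right l m : f l <= f l.+1 -> (l <= m)%N -> f l <= f m.
Proof.
move=> hl; elim: m => [|m IH]; first by rewrite leqn0 => /eqP ->.
rewrite leq_eqVlt ltnS => /predU1P[->//|lm].
by apply: (le_trans (IH lm)); have := convex_slope_le lm; lra.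
Qed.

Lemma convex_min_left l m : f l.+1 <= f l -> (m <= l.+1)%N -> f l.+1 <= f m.
Proof.
elim: l => [|l IH] hl; rewrite leq_eqVlt ltnS => /predU1P[->//|ml].
  by move: ml; rewrite leqn0 => /eqP ->.
by apply: (le_trans hl); apply: IH => //; have := f_convex l; lra.
Qed.

End ConvexSequence.

(** * Sets of indices: initial segments and comparison at equal size *)

(** As the two sets have the same size, subtracting v from every value does not
    change the difference of the two sums, and then every index contributes to
    it with the same sign.  In the equality case each contribution vanishes. *)
Lemma sum_le_threshold (R : realType) (I : finType) (g : I -> R) (v : R)
    (S T : {set I}) :
  #|S| = #|T| -> (forall i, i \in T -> v <= g i) ->
  (forall i, i \notin T -> g i <= v) ->
  \sum_(i in S) g i <= \sum_(i in T) g i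
  /\ (\sum_(i in T) g i <= \sum_(i in S) g i ->
      forall i, (i \in S) != (i \in T) -> g i = v).
Proof.
move=> cST hT hC.
have sumE (A : {set I}) :
    \sum_(i in A) g i = \sum_i (i \in A)%:R * (g i - v) + #|A|%:R * v.
  rewrite mulr_natl -sumr_const [X in _ + X]big_mkcond [LHS]big_mkcond.
  rewrite -big_split.
  by apply: eq_bigr => i _; case: (i \in A) => /=; ring.
have diffE : \sum_(i in T) g i - \sum_(i in S) g i =
    \sum_i ((i \in T)%:R - (i \in S)%:R) * (g i - v).
  rewrite !sumE cST opprD addrACA subrr addr0 -sumrB.
  by apply: eq_bigr => i _; rewrite mulrBl.
have term_ge0 i : true -> 0 <= ((i \in T)%:R - (i \in S)%:R) * (g i - v).
  move=> _; have [/hT|/hC] := boolP (i \in T); case: (i \in S) => /= h; nra.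
split; first by rewrite -subr_ge0 diffE sumr_ge0.
rewrite -subr_le0 diffE => le0 i.
have /eqP : \sum_i ((i \in T)%:R - (i \in S)%:R) * (g i - v) = 0.
  by apply/eqP; rewrite eq_le le0 sumr_ge0.
rewrite psumr_eq0// => /allP /(_ i (mem_index_enum _)) /=.
rewrite mulf_eq0 => /orP[]; case: (i \in T); case: (i \in S) => //= /eqP; lra.
Qed.

Lemma sum_prefix (R : realType) (n k : nat) (F : 'I_n -> R) (G : nat -> R) :
  (k <= n)%N -> (forall i : 'I_n, F i = G i) ->
  \sum_(i < n | (i < k)%N) F i = \sum_(i < k) G i.
Proof.
move=> kn FG; rewrite (eq_bigr (fun i : 'I_n => G i)) => [|i _]; last exact: FG.
exact: esym (big_ord_widen _ G kn).
Qed.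

Lemma card_prefix (n k : nat) :
  (k <= n)%N -> #|[set i : 'I_n | (i < k)%N]%SET| = k.
Proof.
move=> kn; rewrite -sum1_card.
rewrite (eq_bigl (fun i : 'I_n => (i < k)%N)) => [|i]; last by rewrite inE.
by rewrite -(big_ord_widen _ (fun=> 1%N) kn) sum1_card card_ord.
Qed.

(** Label each index i by y i and by its membership in a set.  The labelings
    coming from S and from T have the same multiset of values, because S and T
    differ only where y is v and have the same size. *)
Lemma exists_perm_transport (A : eqType) (n : nat) (y : 'I_n -> A) (v : A)
    (S T : {set 'I_n}) :
  #|S| = #|T| -> (forall i, (i \in S) != (i \in T) -> y i = v) ->
  exists p : 'S_n, forall i, y (p i) = y i /\ (p i \in S) = (i \in T).
Proof.
move=> cST hv.
pose lab (U : {set 'I_n}) := [tuple (y i, i \in U) | i < n].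
suff /tuple_permP[p hp] : perm_eq (lab T) (lab S).
  have {}hp : lab T = [tuple tnth (lab S) (p i) | i < n] by exact/val_inj.
  exists p => i; move/(congr1 (fun t => tnth t i)): hp.
  by rewrite !tnth_mktuple => -[-> ->].
apply/seq.permP => a.
have countE U : count a (lab U) = (\sum_i a (y i, i \in U))%N.
  rewrite /= count_map -sum1_count big_enum_cond/= big_mkcond.
  by apply: eq_bigr => i _ /=; case: ifP.
have constE (U : {set 'I_n}) : 
    (\sum_i a (v, i \in U) =
     #|U| * a (v, true) + (n - #|U|) * a (v, false))%N.
  rewrite (bigID (mem U)) /=; congr (_ + _)%N.
    by rewrite -sum_nat_const; apply: eq_bigr => i ->.
  have -> : (n - #|U|)%N = #|~: U|.
    by rewrite (cardsCs (~: U)) finset.setCK card_ord.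
  rewrite -sum_nat_const; apply: eq_big => [i|i /negbTE ->//]; by rewrite inE.
(* The number of labels (v, i \in S) that pass the test depends only on the
   size of S; once it is added, the two counts agree index by index. *)
rewrite !countE; apply/eqP; rewrite -(eqn_add2r (\sum_i a (v, i \in S))).
rewrite {2}constE cST -constE -!big_split; apply/eqP/eq_bigr => i _ /=.
have [->//|/hv ->] := eqVneq (i \in S) (i \in T); exact: addnC.
Qed.

(** * Permutation and signed permutation matrices *)

Lemma perm_mx_mulE (R : realType) (n : nat) (s : 'S_n) (x : 'cV[R]_n) i :
  (perm_mx s *m x) i 0 = x (s i) 0.
Proof. by rewrite -row_permE mxE. Qed.

Lemma dot_perm_mx (R : realType) (n : nat) (s : 'S_n) (x y : 'cV[R]_n) :
  dot (perm_mx s *m x) (perm_mx s *m y) = dot x y.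
Proof.
rewrite /dot [RHS](reindex_inj (@perm_inj _ s)).
by apply: eq_bigr => i _; rewrite !perm_mx_mulE.
Qed.

Lemma signed_perm_mxP (R : realType) (n : nat) (P : 'M[R]_n) :
  signed_perm_mx P ->
  [/\ P *m P^T = 1%:M, P^T *m P = 1%:M,
    forall x : 'cV[R]_n, enorm (P *m x) = enorm x
    & forall x : 'cV[R]_n, l0norm (P *m x) = l0norm x].
Proof.
move=> [eps [s ->]]; set D := diag_mx _.
have DD : D *m D = 1%:M.
  rewrite /D mulmx_diag -diag_const_mx; congr diag_mx; apply/rowP => i.
  by rewrite !mxE -signr_addb addbb.
have PE (x : 'cV[R]_n) i :
    ((D *m perm_mx s) *m x) i 0 = (-1) ^+ eps i * x (s i) 0.
  by rewrite -mulmxA mul_diag_mx mxE perm_mx_mulE mxE.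
have PPT : (D *m perm_mx s) *m (D *m perm_mx s)^T = 1%:M.
  rewrite trmx_mul tr_diag_mx mulmxA -(mulmxA D) tr_perm_mx -perm_mxM mulgV.
  by rewrite perm_mx1 mulmx1.
split=> // [|x|x]; first exact: mulmx1C.
  congr Num.sqrt; rewrite [RHS](reindex_inj (@perm_inj _ s)).
  apply: eq_bigr => i _; by rewrite PE exprMn sqrr_sign mul1r.
rewrite /l0norm -!sum1_card [RHS](reindex_inj (@perm_inj _ s)).
by apply: eq_bigl => i; rewrite !inE PE mulf_eq0 signr_eq0.
Qed.

Lemma perm_mx_signed (R : realType) (n : nat) (s : 'S_n) :
  signed_perm_mx (perm_mx s : 'M[R]_n).
Proof.
exists (fun=> false), s.
have -> : \row_(i < n) (-1) ^+ false = const_mx 1 :> 'rV[R]_n.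
  by apply/rowP => i; rewrite !mxE expr0.
by rewrite diag_const_mx mul1mx.
Qed.

(** * Minimizers for a sorted nonnegative vector *)

(** On the unit sphere |x - y|^2 / 2 is -<x, y> plus a constant. *)
Lemma QsetP (R : realType) (n : nat) (nu : R) (y x : 'cV[R]_n) :
  Qset nu y x <-> enorm x = 1 /\ forall w, enorm w = 1 ->
    nu * (l0norm x)%:R - dot x y <= nu * (l0norm w)%:R - dot w y.
Proof.
split=> -[x1 hx]; split=> // w w1; have := hx w w1;
  rewrite lee_fin !sqr_enormB x1 w1; lra.
Qed.

Lemma l0norm_bounds (R : realType) (n : nat) (x : 'cV[R]_n) :
  enorm x = 1 -> (0 < l0norm x <= n)%N.
Proof.
move=> x1; have -> : (l0norm x <= n)%N.
  by rewrite -[leqRHS](card_ord n) max_card.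
rewrite andbT lt0n.
apply/negP => /eqP/card0_eq h; have : enorm x ^+ 2 = 1 by rewrite x1 expr1n.
rewrite sqr_enorm big1 => [/eqP|i _]; first by rewrite eq_sym oner_eq0.
by have /negbFE/eqP -> := h i; rewrite expr0n.
Qed.

Section SortedVector.
Variables (R : realType) (n : nat) (y : 'cV[R]_n).
Hypotheses (y_neq0 : y != 0)
  (y_anti : forall i j : 'I_n, (i <= j)%N -> y j 0 <= y i 0)
  (y_ge0 : forall i : 'I_n, 0 <= y i 0).

Let Y k := (sort_desc y)`_k.

Lemma sort_desc_id : sort_desc y = [seq y i 0 | i <- enum 'I_n].
Proof.
apply: sorted_sort; first by move=> a b c /= ba cb; exact: le_trans cb ba.
rewrite sorted_map; apply: (@sub_sorted _ (relpre val leq)) => [i j /=|].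
  exact: y_anti.
by rewrite -sorted_map val_enum_ord iota_sorted.
Qed.

Lemma nth_sort_desc (i : 'I_n) : Y i = y i 0.
Proof.
by rewrite /Y sort_desc_id (nth_map i) ?size_enum_ord// nth_ord_enum.
Qed.

Lemma nth_sort_desc_default k : (n <= k)%N -> Y k = 0.
Proof.
by move=> nk; rewrite /Y nth_default// sort_desc_id size_map size_enum_ord.
Qed.

Lemma sortv_id : sortv y = y.
Proof. by apply/colP => i; rewrite mxE -nth_sort_desc. Qed.

Lemma nth_sort_desc_ge0 k : 0 <= Y k.
Proof.
have [kn|nk] := ltnP k n; last by rewrite nth_sort_desc_default.
by rewrite (nth_sort_desc (Ordinal kn)).
Qed.

Lemma nth_sort_desc_anti j k : (j <= k)%N -> Y k <= Y j.
Proof.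
have [kn|nk] := ltnP k n => jk.
  rewrite (nth_sort_desc (Ordinal kn)).
  by rewrite (nth_sort_desc (Ordinal (leq_ltn_trans jk kn))) y_anti.
by rewrite (nth_sort_desc_default nk) nth_sort_desc_ge0.
Qed.

Lemma head_sort_desc_gt0 : 0 < Y 0.
Proof.
rewrite lt_def nth_sort_desc_ge0 andbT; apply: contra y_neq0 => /eqP Y0.
apply/eqP/colP => i; rewrite mxE -nth_sort_desc; apply/eqP.
by rewrite eq_le nth_sort_desc_ge0 -Y0 nth_sort_desc_anti.
Qed.

Lemma enorm_top k : enorm (top k y) = prefix_norm Y k.
Proof. by congr Num.sqrt; apply: eq_bigr => i _; rewrite mxE. Qed.

Lemma chiS k : chi k.+1 y = prefix_norm Y k.+1 - prefix_norm Y k.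
Proof. by rewrite /chi !enorm_top. Qed.

(** As y is continued by zeros, the condition chi_(l+1) <= nu holds
    automatically at l = n. *)
Lemma chi_past : chi n.+1 y = 0.
Proof.
rewrite chiS /prefix_norm big_ord_recr /= nth_sort_desc_default//.
by rewrite expr0n addr0 subrr.
Qed.

Lemma chi_anti j k : (0 < j <= k)%N -> chi k y <= chi j y.
Proof.
case: j => // j /andP[_]; case: k => // k; rewrite ltnS => jk; rewrite !chiS.
pose f m := - prefix_norm Y m.
have cvx i : f i.+1 - f i <= f i.+2 - f i.+1.
  have := prefix_norm_concave nth_sort_desc_ge0 nth_sort_desc_anti i.
  by rewrite /f; lra.
by have := convex_slope_le cvx jk; rewrite /f; lra.
Qed.

Let trunc k := pad0 n (normalize (top k y)).

Lemma truncE k (i : 'I_n) :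
  trunc k i 0 = if (i < k)%N then (prefix_norm Y k)^-1 * y i 0 else 0.
Proof.
rewrite mxE; case: insubP => [j -> /= ji|/negbTE -> //].
by rewrite !mxE enorm_top ji -nth_sort_desc.
Qed.

Lemma enorm_trunc k : (0 < k <= n)%N -> enorm (trunc k) = 1.
Proof.
move=> /andP[k0 kn]; have pk := prefix_norm_gt0 head_sort_desc_gt0 k0.
apply/eqP; rewrite -(eqrXn2 (n := 2))// ?enorm_ge0// sqr_enorm expr1n.
pose G i := (prefix_norm Y k)^-2 * Y i ^+ 2.
rewrite (eq_bigr (fun i : 'I_n => if (i < k)%N then G i else 0)).
  rewrite -big_mkcond (sum_prefix (G := G))//.
  by rewrite -mulr_sumr -sqr_prefix_norm mulVf// expf_neq0// gt_eqF.
move=> i _; rewrite truncE -nth_sort_desc.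
by case: ifP => _; rewrite ?expr0n// exprMn exprVn.
Qed.

Lemma dot_trunc k : (0 < k <= n)%N -> dot (trunc k) y = prefix_norm Y k.
Proof.
move=> /andP[k0 kn]; have pk := prefix_norm_gt0 head_sort_desc_gt0 k0.
pose G i := (prefix_norm Y k)^-1 * Y i ^+ 2.
rewrite /dot (eq_bigr (fun i : 'I_n => if (i < k)%N then G i else 0)).
  rewrite -big_mkcond (sum_prefix (G := G))//.
  by rewrite -mulr_sumr -sqr_prefix_norm expr2 mulKf// gt_eqF.
move=> i _; rewrite truncE -nth_sort_desc.
by case: ifP => _; rewrite ?mul0r// -mulrA.
Qed.

(** Only an inequality, as y may have zeros among its first k entries. *)
Lemma l0norm_trunc k : (k <= n)%N -> (l0norm (trunc k) <= k)%N.
Proof.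
move=> kn; rewrite -[leqRHS](card_prefix kn).
apply/subset_leq_card/fintype.subsetP => i.
by rewrite !inE truncE; case: ifP => //; rewrite eqxx.
Qed.

(** With s the support size of x and t = p_s, expanding the sum of
    (t x_i - y_i)^2 over the support S of x gives
    0 <= t^2 - 2 t <x, y> + (sum over S of y_i^2) <= 2 t (t - <x, y>),
    which is the bound.  When <x, y> >= t both inequalities are equalities, so
    that x = y / t on S, and S carries as much of the norm of y as the first s
    positions do. *)
Lemma dot_le_prefix_norm (x : 'cV[R]_n) : enorm x = 1 ->
  dot x y <= prefix_norm Y (l0norm x)
  /\ (prefix_norm Y (l0norm x) <= dot x y ->
      exists s : 'S_n, perm_mx s *m y = y /\ perm_mx s *m x = trunc (l0norm x)).
Proof.
move=> x1; have /andP[s0 sn] := l0norm_bounds x1.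
set s := l0norm x in s0 sn *; set t := prefix_norm Y s.
have t0 : 0 < t by exact: prefix_norm_gt0 head_sort_desc_gt0 s0.
pose S := [set i : 'I_n | x i 0 != 0]%SET.
pose T := [set i : 'I_n | (i < s)%N]%SET.
have cS : #|S| = s by apply: eq_card => i; rewrite !inE.
have cST : #|S| = #|T| by rewrite cS card_prefix.
have sumT : \sum_(i in T) y i 0 ^+ 2 = t ^+ 2.
  rewrite /t sqr_prefix_norm.
  rewrite -(sum_prefix (F := fun i => y i 0 ^+ 2)
              (G := fun i => Y i ^+ 2) sn) => [|i].
    by apply: eq_bigl => i; rewrite inE.
  by rewrite nth_sort_desc.
(* The threshold comes from the s-th largest entry of y, of index s - 1. *)
have [sumST eqST] : \sum_(i in S) y i 0 ^+ 2 <= \sum_(i in T) y i 0 ^+ 2 /\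
   (\sum_(i in T) y i 0 ^+ 2 <= \sum_(i in S) y i 0 ^+ 2 ->
    forall i, (i \in S) != (i \in T) -> y i 0 ^+ 2 = Y s.-1 ^+ 2).
  have Yge := nth_sort_desc_ge0.
  apply: sum_le_threshold => // i; rewrite inE -nth_sort_desc => h;
    rewrite lerXn2r ?nnegrE// nth_sort_desc_anti//.
    by rewrite -ltnS prednK.
  by rewrite -leqNgt in h; exact: leq_trans (leq_pred _) h.
have sqE : \sum_(i in S) (t * x i 0 - y i 0) ^+ 2 =
    t ^+ 2 - 2 * t * dot x y + \sum_(i in S) y i 0 ^+ 2.
  have -> : t ^+ 2 = t ^+ 2 * \sum_i x i 0 ^+ 2.
    by rewrite -sqr_enorm x1 expr1n mulr1.
  rewrite /dot !mulr_sumr -sumrB [X in _ + X]big_mkcond [LHS]big_mkcond.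
  rewrite -big_split.
  apply: eq_bigr => i _ /=; case: ifP; first by move=> _; ring.
  by rewrite inE => /negbFE/eqP ->; ring.
have sq_ge0 : 0 <= \sum_(i in S) (t * x i 0 - y i 0) ^+ 2.
  by apply: sumr_ge0 => i _; exact: sqr_ge0.
rewrite sumT in sumST eqST; split; first by nra.
move=> tle.
have sq0 : \sum_(i in S) (t * x i 0 - y i 0) ^+ 2 = 0.
  by apply/eqP; rewrite eq_le sq_ge0 andbT; nra.
have yv i : (i \in S) != (i \in T) -> y i 0 = Y s.-1.
  move=> ST; apply/eqP; rewrite -(eqrXn2 (n := 2))// ?nth_sort_desc_ge0//.
  by apply/eqP/eqST => //; nra.
have xE i : i \in S -> x i 0 = t^-1 * y i 0.
  move=> iS; move/eqP: sq0; rewrite psumr_eq0 => [|j _]; last exact: sqr_ge0.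
  move=> /allP/(_ i (mem_index_enum _)).
  rewrite iS sqrf_eq0 subr_eq0 => /eqP <-; by rewrite mulKf// gt_eqF.
have [p hp] := exists_perm_transport cST yv.
exists p; split; apply/colP => i; rewrite [i in X in _ = X]/= perm_mx_mulE.
  exact: (hp i).1.
have [hy] := hp i; rewrite [in X in _ = X -> _]inE truncE => <-.
case: ifP => [/xE ->|]; first by rewrite hy.
by rewrite inE => /negbFE/eqP.
Qed.

Lemma trunc_full : trunc n = normalize y.
Proof.
have topy : top n y = y by apply/colP => i; rewrite mxE -/(Y i) nth_sort_desc.
rewrite /trunc topy; apply/colP => i; rewrite mxE.
by case: insubP => [j _ /val_inj -> //|]; rewrite ltn_ord.
Qed.

Lemma trunc1 (n_gt0 : (0 < n)%N) : trunc 1 = delta_mx (Ordinal n_gt0) 0.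
Proof.
apply/colP => i; rewrite truncE mxE andbT ltnS leqn0 -val_eqE /=.
case: eqP => // i0; rewrite prefix_norm1; last exact: nth_sort_desc_ge0.
by rewrite -nth_sort_desc i0 mulVf// gt_eqF// head_sort_desc_gt0.
Qed.

Lemma top_truncationsP l (x : 'cV[R]_n) : top_truncations l y x <->
  exists s : 'S_n, perm_mx s *m y = y /\ perm_mx s *m x = trunc l.
Proof.
split.
  move=> [P [/is_perm_mxP[s ->]]]; rewrite sortv_id => hy <-.
  have [PPT _ _ _] := signed_perm_mxP (perm_mx_signed R s).
  by exists s; rewrite mulmxA PPT mul1mx.
move=> [s [hy hx]]; have [_ PTP _ _] := signed_perm_mxP (perm_mx_signed R s).
exists (perm_mx s); last by rewrite -/(trunc l) -hx mulmxA PTP mul1mx.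
by split; [exact: perm_mx_is_perm | rewrite sortv_id].
Qed.

Lemma top_truncations_full (x : 'cV[R]_n) :
  top_truncations n y x <-> x = normalize y.
Proof.
rewrite top_truncationsP trunc_full; split=> [[s [hy hx]]|->]; last first.
  by exists 1%g; rewrite perm_mx1 !mul1mx.
have [_ PTP _ _] := signed_perm_mxP (perm_mx_signed R s).
rewrite -[x]mul1mx -PTP -mulmxA hx -[in LHS]hy /normalize.
by rewrite -scalemxAr mulmxA PTP mul1mx hy.
Qed.

Lemma top_truncations1 (n_gt0 : (0 < n)%N) (x : 'cV[R]_n) :
  top_truncations 1 y x <->
  exists2 i : 'I_n, y i 0 = y (Ordinal n_gt0) 0 & delta_mx i 0 = x.
Proof.
rewrite top_truncationsP trunc1; split=> [[s [hy hx]]|[i hi <-]].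
  exists (s (Ordinal n_gt0)); first by rewrite -perm_mx_mulE hy.
  apply/colP => j; rewrite -[j in RHS](permKV s) -perm_mx_mulE hx !mxE.
  by rewrite -[in RHS](inj_eq (@perm_inj _ s)) permKV.
exists (tperm (Ordinal n_gt0) i); split; apply/colP => j; rewrite perm_mx_mulE.
  by case: tpermP => [->|->|].
rewrite !mxE -[in RHS](inj_eq (@perm_inj _ (tperm (Ordinal n_gt0) i))).
by rewrite tpermL.
Qed.

(** The minimizers are the truncations of length l for the l that minimize
    phi k = nu k - p_k over 1 <= k <= n, and by convexity of phi it suffices to
    compare phi l with its two neighbours.  The neighbour 0 is out of range,
    so that l = 1 needs no upper bound on nu: such a bound would fail for
    nu > chi_1. *)
Lemma Qset_sortedE (nu : R) (x : 'cV[R]_n) : 0 < nu -> Qset nu y x <->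
  exists l, [/\ (0 < l <= n)%N, chi l.+1 y <= nu, l = 1%N \/ nu <= chi l y
    & top_truncations l y x].
Proof.
move=> nu0; pose phi k := nu * k%:R - prefix_norm Y k.
have phiS k : phi k.+1 - phi k = nu - chi k.+1 y.
  by rewrite /phi chiS -natr1; ring.
have phi_convex k : phi k.+1 - phi k <= phi k.+2 - phi k.+1.
  by rewrite !phiS; have := @chi_anti k.+1 k.+2 (leqnSn _); lra.
split=> [/QsetP[x1 hx]|[l [ln hl hl' /top_truncationsP[s [hy hs]]]]].
  have ln := l0norm_bounds x1; set l := l0norm x in ln *.
  have [dle deq] := dot_le_prefix_norm x1.
  (* Compare x with the truncation of length k; as the truncation has at most
     k nonzero entries, its penalty is at most nu k. *)
  have phi_le k : (0 < k <= n)%N -> nu * l%:R - dot x y <= phi k.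
    move=> kn; have := hx _ (enorm_trunc kn); rewrite dot_trunc//.
    have /l0norm_trunc : (k <= n)%N by case/andP: kn.
    by rewrite -(ler_nat R) /phi -/l; nra.
  have dge : prefix_norm Y l <= dot x y.
    by have := phi_le _ ln; rewrite /phi; lra.
  have phi_min k : (0 < k <= n)%N -> phi l <= phi k.
    by move=> /phi_le; apply: le_trans; rewrite /phi; lra.
  exists l; split => //; last by apply/top_truncationsP/deq.
    have [ln'|nl] := ltnP l n.
      by have := phi_min l.+1 ln'; have := phiS l; lra.
    have lE : l = n by apply/eqP; rewrite eqn_leq nl; case/andP: ln => _ ->.
    by rewrite lE chi_past ltW.
  case: (l) ln phi_min => [//|[|k]] ln phi_min; [by left|right].
  by have := phi_min k.+1 (ltnW ln); have := phiS k.+1; lra.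
have phi_min k : (0 < k)%N -> phi l <= phi k.
  have [lk _|kl k0] := leqP l k.
    by apply: convex_min_right => //; have := phiS l; lra.
  case: l hl' kl {ln hl hs} => // l [-> |hl'] kl; first by case: k k0 kl.
  by apply: convex_min_left => //; [have := phiS l; lra|exact: ltnW].
have [_ _ /(_ x) Px_norm /(_ x) Px_l0] := signed_perm_mxP (perm_mx_signed R s).
have x1 : enorm x = 1 by rewrite -Px_norm hs enorm_trunc.
have xd : dot x y = prefix_norm Y l.
  by rewrite -(dot_perm_mx s) hs hy dot_trunc.
have xl : (l0norm x <= l)%N by rewrite -Px_l0 hs l0norm_trunc//; case/andP: ln.
apply/QsetP; split => // w w1.
have /andP[w0 _] := l0norm_bounds w1; have [wd _] := dot_le_prefix_norm w1.
have := phi_min _ w0; rewrite /phi xd; move: xl; rewrite -(ler_nat R); nra.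
Qed.

End SortedVector.

(** * The proximal mapping *)

(** The indicator makes every point off the sphere worse than any point on it
    (for this the sphere must be nonempty, hence 0 < n), and on the sphere the
    two objectives are proportional with factor 1/tau. *)
Lemma prox_gfunE (R : realType) (n : nat) (n_gt0 : (0 < n)%N) (lambda tau : R)
    (z : 'cV[R]_n) : 0 < tau ->
  prox tau (gfun lambda) z = Qset (tau * lambda) z.
Proof.
move=> tau0; have e1 : exists e : 'cV[R]_n, enorm e = 1.
  exists (normalize (const_mx 1)); apply: enorm_normalize.
  by apply/eqP => /colP/(_ (Ordinal n_gt0)) /eqP; rewrite !mxE oner_eq0.
have onS w : enorm w = 1 ->
    (((2 * tau)^-1 * enorm (w - z) ^+ 2)%:E + gfun lambda w)%E =
    (tau^-1 * (2^-1 * enorm (w - z) ^+ 2 + tau * lambda * (l0norm w)%:R))%:E.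
  move=> w1; rewrite /gfun /delta_set asboolT// add0e -EFinD; congr EFin.
  by field; rewrite gt_eqF.
have offS w : enorm w <> 1 ->
    (((2 * tau)^-1 * enorm (w - z) ^+ 2)%:E + gfun lambda w)%E = +oo%E.
  by move=> w1; rewrite /gfun /delta_set asboolF.
apply/seteqP; split=> x /=.
  move=> [_ hx]; have x1 : enorm x = 1.
    have [//|x1] := eqVneq (enorm x) 1; have [e e1'] := e1.
    by have := hx e I; rewrite (offS x (elimN eqP x1)) onS.
  split=> // w w1; have := hx w I; rewrite !onS// !lee_fin ler_pM2l//.
  by rewrite invr_gt0.
move=> [x1 hx]; split=> // w _; have [w1|/eqP w1] := eqVneq (enorm w) 1.
  by have := hx w w1; rewrite !onS// !lee_fin ler_pM2l// invr_gt0.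
by rewrite (offS w)// leey.
Qed.

Lemma Qset_signed_perm (R : realType) (n : nat) (P : 'M[R]_n) (nu : R)
    (z : 'cV[R]_n) : signed_perm_mx P ->
  Qset nu z = [set P^T *m x | x in Qset nu (P *m z)].
Proof.
move=> /signed_perm_mxP[PPT PTP Pe Pl].
have PK (x : 'cV[R]_n) : P^T *m (P *m x) = x by rewrite mulmxA PTP mul1mx.
have PTK (x : 'cV[R]_n) : P *m (P^T *m x) = x by rewrite mulmxA PPT mul1mx.
apply/seteqP; split=> x /=.
  move=> [x1 hx]; exists (P *m x) => //; split; first by rewrite /sphere /= Pe.
  move=> w w1; have := hx (P^T *m w); rewrite /sphere /= -Pe PTK => /(_ w1).
  by rewrite -[in X in _ -> (_ <= X)%E](PTK w) -!mulmxBr !Pe !Pl.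
move=> [w [w1 hw] <-]; split; first by rewrite /sphere /= -Pe PTK.
move=> v v1; have := hw (P *m v); rewrite /sphere /= Pe => /(_ v1).
by rewrite -{1 2}(PTK w) -!mulmxBr !Pe !Pl.
Qed.

(** * The theorem *)

Theorem proposition2p1 (R : realType) (n : nat) (n_gt0 : (0 < n)%N) :
  (forall lambda tau : R, 0 < lambda -> 0 < tau ->
   forall (z : 'cV[R]_n) (P : 'M[R]_n),
     signed_perm_mx P -> P *m z = sortv (absv z) ->
     prox tau (gfun lambda) z =
       [set P^T *m x | x in Qset (tau * lambda) (sortv (absv z))])
  /\
  (forall (y : 'cV[R]_n) (nu : R),
     y != 0 ->
     (forall i j : 'I_n, (i <= j)%N -> y j 0 <= y i 0) ->
     (forall i : 'I_n, 0 <= y i 0) ->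
     0 < nu ->
     [/\ nu < chi n y -> Qset nu y = [set normalize y],
         chi 1 y <= nu ->
           Qset nu y =
             [set (y i 0 / `|y i 0|) *: delta_mx i 0 |
               i in [set i : 'I_n | y i 0 = y (Ordinal n_gt0) 0]]
       & chi n y <= nu -> nu < chi 1 y ->
           Qset nu y =
             [set x | exists l : nat,
               [/\ (0 < l <= n)%N, chi l.+1 y <= nu <= chi l y
                 & top_truncations l y x]]]).
Proof.
split=> [lambda tau _ tau0 z P hP hz|y nu y0 y_anti y_ge0 nu0].
  by rewrite prox_gfunE// -hz; exact: Qset_signed_perm.
have Y0 := head_sort_desc_gt0 y0 y_anti y_ge0.
have Yge := nth_sort_desc_ge0 y_anti y_ge0.
have Yanti := nth_sort_desc_anti y_anti y_ge0.
have chiA := chi_anti y_anti y_ge0.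
have QE x := Qset_sortedE y0 y_anti y_ge0 x nu0.
have chi21 : chi 2 y < chi 1 y.
  by rewrite !chiS prefix_norm0 subr0; exact: prefix_norm2_lt.
split=> [hnu|hnu|_ hnu].
- apply/seteqP; split=> x /=.
    move=> /QE[l [/andP[l0 ln] hl _]].
    have -> : l = n.
      apply/eqP; rewrite eqn_leq ln leqNgt; apply/negP => ln'.
      by have := chiA l.+1 n ln'; lra.
    exact: (top_truncations_full y_anti x).1.
  move=> ->; apply/QE; exists n; split; rewrite ?n_gt0 ?leqnn//.
  + by rewrite chi_past// ltW.
  + by right; exact: ltW.
  + exact/(top_truncations_full y_anti).
- have -> : [set (y i 0 / `|y i 0|) *: delta_mx i 0 |
      i in [set i : 'I_n | y i 0 = y (Ordinal n_gt0) 0]] = top_truncations 1 y.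
    apply/seteqP; split=> x /=.
      move=> [i hi <-]; apply/(top_truncations1 y0 y_anti y_ge0 n_gt0).
      exists i => //; rewrite hi ger0_norm// divff ?scale1r//.
      by rewrite -(nth_sort_desc y_anti) gt_eqF.
    move=> /(top_truncations1 y0 y_anti y_ge0 n_gt0)[i hi <-]; exists i => //.
    rewrite hi ger0_norm// divff ?scale1r//.
    by rewrite -(nth_sort_desc y_anti) gt_eqF.
  apply/seteqP; split=> x /=.
    move=> /QE[l [/andP[l0 ln] _ [->//|hl] hx]].
    have [l1|l2] := leqP l 1.
      by rewrite -(_ : l = 1%N)//; apply/eqP; rewrite eqn_leq l1.
    by have := chiA 2 l l2; lra.
  move=> hx; apply/QE; exists 1%N; split => //; last by left.
  exact: le_trans (ltW chi21) hnu.
apply/seteqP; split=> x /=.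
  move=> /QE[l [ln hl hl' hx]]; exists l; split => //.
  by rewrite hl /=; case: hl' => // ->; exact: ltW.
move=> [l [ln /andP[hl hl'] hx]]; apply/QE; exists l; split => //; by right.
Qed.
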